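(* Let $G=(V,E)$ be a finite loopless multigraph, $K\subseteq V$ with $|K|\ge2$, and $(G^1,G^2,X)$ a $K$-splitting of $(G,K)$. Then \[ M(G,K)=M(G^1_X,K^1_X)\,M(G^2_X,K^2_X)\sum_{\sigma_1,\sigma_2\in\Pi_l(X,\pi_X)}D(G^1,\sigma_1)\,m(\sigma_1\vee\sigma_2)\,D(G^2,\sigma_2). \]
   Context: Labelled set partitions: for a finite set $Y$ and a symbol $l\notin Y$, a labelled set partition of $Y$ is $\pi=\{B_1\cup L_1,\dots,B_k\cup L_k\}$ with $\{B_1,\dots,B_k\}$ a set partition of $Y$ and $L_i\in\{\emptyset,\{l\}\}$ (labelled block iff $L_i=\{l\}$). $\Pi_l(Y)$ is the set of these, ordered by $\sigma\le\pi$ iff every block of $\sigma$ (including $l$ if present) is contained in a block of $\pi$; it is a lattice with join $\vee$. $m(\pi)=1$ if $\pi$ has exactly one labelled block, else $0$. Restriction: for $\pi\in\Pi_l(W)$ and $Y\subseteq W$, $\pi\sqcap Y\in\Pi_l(Y)$ has the blocks $(B\cap Y)\cup L$ for the blocks $B\cup L$ of $\pi$ with $B\cap Y\ne\emptyset$. Graphs may have parallel edges but no loops. For a graph $H$ on vertex set $W$ and $K'\subseteq W$: $M(H,K')=1$ if all vertices of $K'$ lie in one connected component of $H$, else $0$; $\{(H,K')\}\in\Pi_l(W)$ is the labelled set partition whose blocks are the vertex sets of the connected components of $H$, a block labelled iff it meets $K'$. For $Y\subseteq W$, $H_Y$ is obtained by identifying all vertices of $Y$ into a single vertex (called $Y$),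 deleting edges with both endpoints in $Y$ and keeping all other edges. $K$-splitting: $G^i=(V^i,E^i)$ subgraphs of $G$ with $E^1\cup E^2=E$, $E^1\cap E^2=\emptyset$, $V^1\cup V^2=V$, $V^1\cap V^2=X$, and $K^i:=K\cap V^i\ne\emptyset$ ($i=1,2$). $K^i_X=(K^i\setminus X)\cup\{X\}$ (terminal set in $G^i_X$). $D(G^i,\pi)=1$ if $\{(G^i,K^i)\}\sqcap X=\pi$ and $0$ otherwise. $\pi_X\in\Pi_l(X)$ is the partition of $X$ into singletons $\{x\}$, labelled iff $x\in K$, and $\Pi_l(X,\pi_X)=\{\pi\in\Pi_l(X):\pi\ge\pi_X,\ \pi\text{ has at least one labelled block}\}$. *)

(* Defs.v *)
From HB Require Import structures.
From mathcomp Require Import all_boot all_order.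

Set Implicit Arguments.
Unset Strict Implicit.
Unset Printing Implicit Defensive.

Import Order.TTheory.

(* The finite sets Y, W, V, ... are sets {set T} over an ambient finite type T.
   A labelled set partition of Y is a set of subsets of [option T], where
   [Some x] stands for the point x and [None] for the extra symbol l. *)

Section LabelledPartitions.
Variable T : finType.
Implicit Types (Y W L : {set T}) (P : {set {set T}}).

Definition lblock (B : {set T}) (b : bool) : {set option T} :=
  Some @: B :|: (if b then [set None] else set0).

(* F is the set of those blocks B_i for which L_i = {l}. *)
Definition is_lpart Y (p : {set {set option T}}) : bool :=
  [exists P : {set {set T}}, exists F : {set {set T}},
     partition P Y && (p == [set lblock B (B \in F) | B in P])].

Record lpart Y :=
  LPart { lpval :> {set {set option T}}; lpvalP : is_lpart Y lpval }.

HB.instance Definition _ Y := [isSub for @lpval Y].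
HB.instance Definition _ Y := [Finite of lpart Y by <:].

Lemma in_lblockS B b x : (Some x \in lblock B b) = (x \in B).
Proof.
rewrite inE mem_imset; last exact: Some_inj.
by case: b; rewrite !inE ?orbF.
Qed.

Lemma in_lblockN B b : (None \in lblock B b) = b.
Proof.
rewrite inE; case: imsetP => [[] // | _].
by case: b; rewrite !inE.
Qed.

Lemma lpart_neq0 Y (s : lpart Y) A : A \in lpval s -> exists x, Some x \in A.
Proof.
have /existsP[P /existsP[F /andP[partP /eqP->]]] := lpvalP s.
case/imsetP=> B PB ->; have /and3P[_ _ P0] := partP.
have /set0Pn[x Bx]: B != set0 by apply: contraNneq P0 => <-.
by exists x; rewrite in_lblockS.
Qed.

Lemma lpart_dom Y (s : lpart Y) A x : A \in lpval s -> Some x \in A -> x \in Y.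
Proof.
have /existsP[P /existsP[F /andP[partP /eqP->]]] := lpvalP s.
case/imsetP=> B PB ->; rewrite in_lblockS.
by apply/subsetP; rewrite -(cover_partition partP); apply: bigcup_sup.
Qed.

Lemma lpart_ex Y (s : lpart Y) x :
  x \in Y -> exists2 A, A \in lpval s & Some x \in A.
Proof.
have /existsP[P /existsP[F /andP[partP /eqP->]]] := lpvalP s.
rewrite -(cover_partition partP) => /bigcupP[B PB Bx].
by exists (lblock B (B \in F)); rewrite ?in_lblockS //; apply: imset_f.
Qed.

Lemma lpart_uniq Y (s : lpart Y) A A' x :
  A \in lpval s -> A' \in lpval s -> Some x \in A -> Some x \in A' -> A = A'.
Proof.
have /existsP[P /existsP[F /andP[partP /eqP->]]] := lpvalP s.
case/imsetP=> B PB -> /imsetP[B' PB' ->]; rewrite !in_lblockS => Bx B'x.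
have /and3P[_ tiP _] := partP.
by rewrite -(def_pblock tiP PB Bx) (def_pblock tiP PB' B'x).
Qed.

(* The block containing the point x (the empty set if x lies outside Y). *)
Definition lblk (s : {set {set option T}}) (x : T) : {set option T} :=
  pblock s (Some x).

Lemma lblkP Y (s : lpart Y) x :
  x \in Y -> lblk s x \in lpval s /\ Some x \in lblk s x.
Proof.
case/(lpart_ex s) => A sA Ax; have cx : Some x \in cover s.
  by apply/bigcupP; exists A.
by rewrite /lblk pblock_mem ?mem_pblock.
Qed.

Lemma lblk_def Y (s : lpart Y) A x :
  A \in lpval s -> Some x \in A -> lblk s x = A.
Proof.
move=> sA Ax; have [sB Bx] := lblkP s (lpart_dom sA Ax).
exact: lpart_uniq sB sA Bx Ax.
Qed.

Lemma lblk_dom Y (s : lpart Y) x y :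
  x \in Y -> Some y \in lblk s x -> y \in Y.
Proof. by case/(lblkP s) => sA _; apply: lpart_dom sA. Qed.

Definition lpart_le Y (s p : lpart Y) : bool :=
  [forall A in lpval s, exists B in lpval p, A \subset B].

Lemma lpart_leP Y (s p : lpart Y) :
  reflect {in Y, forall x, lblk s x \subset lblk p x} (lpart_le s p).
Proof.
apply: (iffP forall_inP) => [le_sp x Yx | le_sp A sA].
  have [sA Ax] := lblkP s Yx; have /exists_inP[B pB sAB] := le_sp _ sA.
  by rewrite (lblk_def pB (subsetP sAB _ Ax)).
have [x Ax] := lpart_neq0 sA; have Yx := lpart_dom sA Ax.
apply/exists_inP; exists (lblk p x); first by case: (lblkP p Yx).
by rewrite -(lblk_def sA Ax) le_sp.
Qed.

Lemma lpart_le_refl Y : reflexive (@lpart_le Y).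
Proof. by move=> s; apply/lpart_leP. Qed.

Lemma lpart_le_trans Y : transitive (@lpart_le Y).
Proof.
move=> s p q /lpart_leP le1 /lpart_leP le2; apply/lpart_leP => x Yx.
exact: subset_trans (le1 x Yx) (le2 x Yx).
Qed.

Lemma lpart_blk_inj Y (s p : lpart Y) :
  {in Y, forall x, lblk s x = lblk p x} -> s = p.
Proof.
move=> e; apply: val_inj; apply/setP => A /=; apply/idP/idP => mA.
  have [x Ax] := lpart_neq0 mA; have Yx := lpart_dom mA Ax.
  by rewrite -(lblk_def mA Ax) e //; case: (lblkP p Yx).
have [x Ax] := lpart_neq0 mA; have Yx := lpart_dom mA Ax.
by rewrite -(lblk_def mA Ax) -e //; case: (lblkP s Yx).
Qed.

Lemma lpart_le_anti Y : antisymmetric (@lpart_le Y).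
Proof.
move=> s p /andP[/lpart_leP le1 /lpart_leP le2].
by apply: lpart_blk_inj => x Yx; apply/eqP; rewrite eqEsubset le1 ?le2.
Qed.

(* The labelled partition with blocks the members of P, where a block is
   labelled iff it meets L. *)
Definition lpart_raw P L : {set {set option T}} :=
  [set lblock B (B :&: L != set0) | B in P].

Lemma lpart_rawP Y P L : partition P Y -> is_lpart Y (lpart_raw P L).
Proof.
move=> partP; apply/existsP; exists P; apply/existsP.
exists [set B | B :&: L != set0]; rewrite partP; apply/eqP.
by apply: eq_imset => B; rewrite inE.
Qed.

Definition mk_lpart Y P L (partP : partition P Y) : lpart Y :=
  LPart (lpart_rawP L partP).

Section FromEquivalence.
Variables (R : rel T) (eqR : equivalence_rel R) (Y L : {set T}).

Lemma lpart_equiv_partition : partition (equivalence_partition R Y) Y.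
Proof. by apply: equivalence_partitionP => x y z _ _ _; apply: eqR. Qed.

Definition lpart_equiv : lpart Y := mk_lpart L lpart_equiv_partition.

Lemma lblk_equiv x : x \in Y ->
  lblk lpart_equiv x = lblock [set y in Y | R x y]
                         ([set y in Y | R x y] :&: L != set0).
Proof.
move=> Yx; apply: lblk_def.
  by apply: (imset_f (fun B => lblock B (B :&: L != set0))); apply: imset_f.
by rewrite in_lblockS inE Yx; have [] := eqR x x x.
Qed.

Lemma lblk_equivS x y : x \in Y ->
  (Some y \in lblk lpart_equiv x) = (y \in Y) && R x y.
Proof. by move=> Yx; rewrite lblk_equiv // in_lblockS inE. Qed.

Lemma lblk_equivN x : x \in Y ->
  reflect (exists y, [/\ y \in Y, R x y & y \in L])
          (None \in lblk lpart_equiv x).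
Proof.
move=> Yx; rewrite lblk_equiv // in_lblockN.
apply: (iffP (set0Pn _)) => [[y /setIP[/setIdP[]]] | [y []]] *; exists y => //.
by rewrite !inE -andbA; apply/and3P.
Qed.

End FromEquivalence.

Section Join.
Variables (Y : {set T}) (s p : lpart Y).

Definition linked : rel T := fun x y =>
  [exists A in lpval s :|: lpval p, (Some x \in A) && (Some y \in A)].

Lemma linked_equiv : equivalence_rel (connect linked).
Proof.
apply/equivalence_relP; split=> [x | ]; first exact: connect0.
have sym : connect_sym linked.
  apply: sym_connect_sym => x y; apply: eq_existsb => A.
  by rewrite [X in _ && X]andbC.
by move=> x y /(same_connect sym).
Qed.

Definition labelled_pts : {set T} :=
  [set x | (None \in lblk s x) || (None \in lblk p x)].

Definition lpart_join : lpart Y := lpart_equiv linked_equiv Y labelled_pts.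

Lemma linkedP x y : reflect
  ((x \in Y) /\ (Some y \in lblk s x \/ Some y \in lblk p x)) (linked x y).
Proof.
apply: (iffP exists_inP) => [[A /setUP[] mA /andP[Ax Ay]] | [Yx []] By].
- by rewrite (lblk_def mA Ax); split; [apply: lpart_dom mA Ax | left].
- by rewrite (lblk_def mA Ax); split; [apply: lpart_dom mA Ax | right].
- by case: (lblkP s Yx) => sA Ax; exists (lblk s x); rewrite ?inE ?sA ?Ax.
by case: (lblkP p Yx) => pA Ax; exists (lblk p x); rewrite ?inE ?pA ?Ax ?orbT.
Qed.

Lemma lpart_joinP q : lpart_le lpart_join q = lpart_le s q && lpart_le p q.
Proof.
apply/idP/andP => [le_jq | [/lpart_leP le_sq /lpart_leP le_pq]].
  split; apply: lpart_le_trans le_jq; apply/lpart_leP => x Yx.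
  - apply/subsetP => -[y Sy | Nx]; last first.
      apply/lblk_equivN => //; exists x; split; rewrite ?connect0 //.
      by rewrite inE Nx.
    rewrite lblk_equivS // (lblk_dom Yx Sy) connect1 //.
    by apply/linkedP; split=> //; left.
  apply/subsetP => -[y Sy | Nx]; last first.
    apply/lblk_equivN => //; exists x; split; rewrite ?connect0 //.
    by rewrite inE Nx orbT.
  rewrite lblk_equivS // (lblk_dom Yx Sy) connect1 //.
  by apply/linkedP; split=> //; right.
have blk_eq x y : connect linked x y -> lblk q x = lblk q y.
  case/connectP => c + ->; elim: c x => //= z c IHc x /andP[lxz /IHc <-].
  have [Yx xz] := linkedP _ _ lxz; have [qA _] := lblkP q Yx.
  apply/esym/(lblk_def qA).
  by case: xz; apply/subsetP; rewrite ?le_sq ?le_pq.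
apply/lpart_leP => x Yx; apply/subsetP => -[y | ].
  rewrite lblk_equivS // => /andP[Yy /blk_eq ->].
  by case: (lblkP q Yy).
case/(lblk_equivN _ _ Yx) => y [Yy /blk_eq -> ]; rewrite inE.
by case/orP; apply/subsetP; rewrite ?le_sq ?le_pq.
Qed.

End Join.

Section Meet.
Variables (Y : {set T}) (s p : lpart Y).

Definition meet_rel : rel T := fun x y =>
  (lblk s x == lblk s y) && (lblk p x == lblk p y).

Lemma meet_rel_equiv : equivalence_rel meet_rel.
Proof.
rewrite /meet_rel => x y z; rewrite !eqxx.
by split=> // /andP[/eqP-> /eqP->].
Qed.

Definition lpart_meet : lpart Y := lpart_equiv meet_rel_equiv Y
  [set x | (None \in lblk s x) && (None \in lblk p x)].

Lemma lpart_meetP q : lpart_le q lpart_meet = lpart_le q s && lpart_le q p.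
Proof.
apply/idP/andP => [le_qm | [/lpart_leP le_qs /lpart_leP le_qp]].
  split; apply: lpart_le_trans le_qm _; apply/lpart_leP => x Yx.
  - apply/subsetP => -[y | ].
      rewrite lblk_equivS // => /and3P[Yy /eqP -> _].
      by case: (lblkP s Yy).
    by case/(lblk_equivN _ _ Yx) => y [Yy /andP[/eqP-> _]] /setIdP[].
  apply/subsetP => -[y | ].
    rewrite lblk_equivS // => /and3P[Yy _ /eqP ->].
    by case: (lblkP p Yy).
  by case/(lblk_equivN _ _ Yx) => y [Yy /andP[_ /eqP->]] /setIdP[].
apply/lpart_leP => x Yx; apply/subsetP => -[y qy | Nx]; last first.
  apply/lblk_equivN => //; exists x; split=> //; first by rewrite /meet_rel !eqxx.
  by rewrite inE !(subsetP _ _ Nx) ?le_qs ?le_qp.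
rewrite lblk_equivS // (lblk_dom Yx qy) /meet_rel /= -!(eq_sym (lblk _ y)).
have [[sA _] [pA _]] := (lblkP s Yx, lblkP p Yx).
rewrite (lblk_def sA) ?(lblk_def pA) ?eqxx //.
  exact: subsetP (le_qp x Yx) _ qy.
exact: subsetP (le_qs x Yx) _ qy.
Qed.

End Meet.

End LabelledPartitions.

Fact lpart_display : Order.disp_t. Proof. exact: Order.Disp tt tt. Qed.

HB.instance Definition _ (T : finType) (Y : {set T}) :=
  Order.Le_isPOrder.Build lpart_display (lpart Y)
    (@lpart_le_refl T Y) (@lpart_le_anti T Y) (@lpart_le_trans T Y).

HB.instance Definition _ (T : finType) (Y : {set T}) :=
  Order.POrder_MeetJoin_isLattice.Build lpart_display (lpart Y)
    (fun s p q => lpart_meetP p q s) (@lpart_joinP T Y).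

Lemma lpart_leE (T : finType) (Y : {set T}) (s p : lpart Y) :
  (s <= p)%O = [forall A in lpval s, exists B in lpval p, A \subset B].
Proof. by []. Qed.

Lemma lpart_joinE (T : finType) (Y : {set T}) (s p : lpart Y) :
  (s `|` p)%O = lpart_join s p.
Proof. by []. Qed.

Section LabelledPartitionOps.
Variable T : finType.
Implicit Types (Y W K : {set T}).

Definition labelled_blocks Y (s : lpart Y) : {set {set option T}} :=
  [set A in lpval s | None \in A].

Definition mfun Y (s : lpart Y) : nat := #|labelled_blocks s| == 1.

(* A block B u L of s with B :&: Y nonempty contributes (B :&: Y) u L. *)
Definition lrestr W (s : lpart W) Y : {set {set option T}} :=
  [set A :&: (None |: Some @: Y) | A in lpval s & A :&: Some @: Y != set0].

Lemma lrestrP W (s : lpart W) Y : Y \subset W -> is_lpart Y (lrestr s Y).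
Proof.
move=> sYW.
have R_eq : equivalence_rel (fun x y => lblk s x == lblk s y).
  by move=> x y z; rewrite eqxx; split=> // /eqP->.
pose t := lpart_equiv R_eq Y [set x | None \in lblk s x].
suff tE x : x \in Y -> lblk t x = lblk s x :&: (None |: Some @: Y).
  suff -> : lrestr s Y = t by apply: lpvalP.
  apply/setP => A; apply/imsetP/idP => [[C /setIdP[sC C0] ->] | tA].
    case/set0Pn: C0 => o /setIP[Co /imsetP[x Yx xE]].
    move: Co; rewrite xE => Cx; rewrite -(lblk_def sC Cx) -tE //.
    by case: (lblkP t Yx).
  have [x Ax] := lpart_neq0 tA; have Yx := lpart_dom tA Ax.
  have [sC Cx] := lblkP s (subsetP sYW x Yx).
  exists (lblk s x); last by rewrite -tE // (lblk_def tA Ax).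
  rewrite inE sC; apply/set0Pn; exists (Some x).
  by rewrite inE Cx imset_f.
move=> Yx; have Wx := subsetP sYW x Yx; apply/setP => -[y | ].
  rewrite lblk_equivS // !inE /= mem_imset; last exact: Some_inj.
  rewrite andbC; case Yy: (y \in Y); rewrite ?andbF ?andbT //.
  have [[sC Cx] [sD Dy]] := (lblkP s Wx, lblkP s (subsetP sYW y Yy)).
  apply/eqP/idP => [-> // | Cy]; exact/esym/(lblk_def sC Cy).
rewrite !inE /= andbT; apply/(lblk_equivN R_eq _ Yx)/idP.
  by case=> y [_ /eqP-> ]; rewrite inE.
by move=> Nx; exists x; rewrite inE Nx eqxx.
Qed.

Lemma singletons_equiv : equivalence_rel (@eq_op T).
Proof. by move=> x y z; rewrite eqxx; split=> // /eqP->. Qed.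

Definition pi_ (X K : {set T}) : lpart X := lpart_equiv singletons_equiv X K.

Lemma pi_E X K :
  pi_ X K = [set lblock [set x] (x \in K) | x in X] :> {set {set option T}}.
Proof.
rewrite /= /lpart_raw /equivalence_partition -imset_comp.
apply: eq_in_imset => x Xx /=.
have -> : [set y in X | x == y] = [set x].
  by apply/setP => y; rewrite !inE eq_sym; case: eqP => [->|]; rewrite ?andbF ?Xx.
congr lblock; apply/set0Pn/idP => [[y /setIP[/set1P->]] // | Kx].
by exists x; rewrite !inE eqxx.
Qed.

Definition PiAbove X (p : lpart X) : {set lpart X} :=
  [set s : lpart X | (p <= s)%O && (labelled_blocks s != set0)].

End LabelledPartitionOps.

(* Finite loopless multigraphs: vertices in T, edges in Te, and [ends e] the
   set of the two (distinct) endpoints of e; [ends] is irrelevant outside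
   [edges]. *)
Record mgraph (T Te : finType) := MGraph {
  vertices : {set T};
  edges : {set Te};
  ends : Te -> {set T};
  ends_sub : {in edges, forall e, ends e \subset vertices};
  ends_card : {in edges, forall e, #|ends e| = 2}
}.

Section Graphs.
Variables (T Te : finType).
Implicit Types (G H : mgraph T Te) (K X Y : {set T}).

Definition subgraph H G : Prop :=
  [/\ vertices H \subset vertices G, edges H \subset edges G
    & {in edges H, forall e, ends H e = ends G e}].

Definition adj H : rel T := fun x y =>
  [exists e in edges H, ends H e == [set x; y]].

Definition components H : {set {set T}} :=
  equivalence_partition (connect (adj H)) (vertices H).

Lemma connect_adj_equiv H : equivalence_rel (connect (adj H)).
Proof.
apply/equivalence_relP; split=> [x | ]; first exact: connect0.
have sym : connect_sym (adj H).
  by apply: sym_connect_sym => x y; apply: eq_existsb => e; rewrite setUC.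
by move=> x y /(same_connect sym).
Qed.

(* The labelled partition written {(H, K)}. *)
Definition lcomp H K : lpart (vertices H) :=
  lpart_equiv (connect_adj_equiv H) (vertices H) K.

Lemma lcompE H K : lcomp H K =
  [set lblock C (C :&: K != set0) | C in components H] :> {set {set option T}}.
Proof. by []. Qed.

Definition Mconn H K : nat := [exists C in components H, K \subset C].

Definition Dfun H K X (s : lpart X) : nat :=
  lrestr (lcomp H K) X == s :> {set {set option T}}.

End Graphs.

(* H_Y has vertex type [option T]: here [None] is the vertex called Y, and
   [Some x] is the old vertex x. *)
Section Identification.
Variables (T Te : finType) (H : mgraph T Te) (Y : {set T}).

Definition contract (x : T) : option T := if x \in Y then None else Some x.

Definition idset (K : {set T}) : {set option T} := None |: Some @: (K :\: Y).

Definition id_edges : {set Te} := [set e in edges H | ~~ (ends H e \subset Y)].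

Lemma id_ends_sub :
  {in id_edges, forall e, contract @: ends H e \subset idset (vertices H)}.
Proof.
move=> e /setIdP[He _]; apply/subsetP => _ /imsetP[x ex ->].
rewrite /contract /idset !inE; case: ifPn => //= nYx.
by rewrite imset_f // inE nYx (subsetP (ends_sub He)).
Qed.

Lemma id_ends_card : {in id_edges, forall e, #|contract @: ends H e| = 2}.
Proof.
move=> e /setIdP[He]; have /eqP/cards2P[x [y [nxy ->]]] := ends_card He.
rewrite imsetU1 imset_set1 cards2 subUset !sub1set /contract.
by case: (x \in Y); case: (y \in Y) => //=; rewrite (inj_eq Some_inj) nxy.
Qed.

Definition identify : mgraph (option T) Te := MGraph id_ends_sub id_ends_card.

End Identification.

Record K_splitting (T Te : finType) (G : mgraph T Te) (K : {set T})
    (G1 G2 : mgraph T Te) (X : {set T}) : Prop := KSplitting {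
  split_sub1 : subgraph G1 G;
  split_sub2 : subgraph G2 G;
  split_edgesU : edges G1 :|: edges G2 = edges G;
  split_edgesI : edges G1 :&: edges G2 = set0;
  split_verticesU : vertices G1 :|: vertices G2 = vertices G;
  split_verticesI : vertices G1 :&: vertices G2 = X;
  split_terms1 : K :&: vertices G1 != set0;
  split_terms2 : K :&: vertices G2 != set0
}.

(* Main.v *)
Require Import Defs.
From mathcomp Require Import all_boot all_order.

(** Write $\sigma_i = \{(G^i,K^i)\}\sqcap X$; the double sum collapses to the
    single term $m(\sigma_1\vee\sigma_2)$, provided both $\sigma_i$ lie in
    $\Pi_l(X,\pi_X)$.  The factor $M(G^i_X,K^i_X)$ says that every terminal of
    $G^i$ is joined to $X$ inside $G^i$.  Two points of $X$ lie in the same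
    block of $\sigma_1\vee\sigma_2$ iff they are connected in $G$ (cut a walk
    of $G$ each time it switches between $G^1$ and $G^2$, which happens in
    $X$), and a block is labelled iff it is connected in $G$ to a terminal.
    So, when all terminals reach $X$, there is exactly one labelled block iff
    $K$ lies in one component of $G$; conversely, if $K$ is connected, a walk
    from a terminal of one side to a terminal of the other must cross $X$. *)

Set Implicit Arguments.
Unset Strict Implicit.
Unset Printing Implicit Defensive.

(** * Connectivity in a multigraph *)

Section Graph.
Variables (T Te : finType) (H : mgraph T Te).
Implicit Types (K X : {set T}).

Lemma adj_sym : symmetric (adj H).
Proof. by move=> x y; apply: eq_existsb => e; rewrite setUC. Qed.

Lemma connect_adj_sym : connect_sym (adj H).
Proof. exact: sym_connect_sym adj_sym. Qed.

Lemma adj_vertices x y :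
  adj H x y -> (x \in vertices H) && (y \in vertices H).
Proof.
case/exists_inP=> e He /eqP eE; have := ends_sub He.
by rewrite eE subUset !sub1set.
Qed.

Lemma connect_vertices x y :
  connect (adj H) x y -> x \in vertices H -> y \in vertices H.
Proof.
case/connectP=> p + ->; elim: p x => //= z p IHp x /andP[/adj_vertices].
by case/andP=> _ Vz hp _; apply: IHp.
Qed.

(** A component containing [K] must be that of [k0], so one base terminal replaces the quantifier
    over components. *)
Lemma MconnP K k0 : K \subset vertices H -> k0 \in K ->
  reflect {in K, forall k, connect (adj H) k0 k}
    [exists C in components H, K \subset C].
Proof.
move=> sKV Kk0; apply: (iffP exists_inP) => [[C /imsetP[x Vx ->] sKC] k Kk | h].
  have := subsetP sKC _ Kk0; have := subsetP sKC _ Kk.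
  rewrite !inE => /andP[_ xk] /andP[_ xk0].
  by apply: connect_trans xk; rewrite connect_adj_sym.
exists [set y in vertices H | connect (adj H) k0 y].
  by apply: imset_f; apply: subsetP Kk0.
by apply/subsetP => k Kk; rewrite inE (subsetP sKV) ?h.
Qed.

End Graph.

(** * Walks after identification of [X] *)

Section Identify.
Variables (T Te : finType) (H : mgraph T Te).
Implicit Types (K X : {set T}).

(** The pair [u], [v] has two distinct elements, so it matches the contracted ends of an edge in one
    of two orders; symmetry of [adj] absorbs the swap. *)
Lemma adj_identify X u v : adj (identify H X) u v ->
  exists x y, [/\ adj H x y, u = contract X x & v = contract X y].
Proof.
case/exists_inP=> e XHe /= /eqP eE; have [He _] := setIdP XHe.
have /eqP/cards2P[x [y [nxy xyE]]] := ends_card He.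
have adjxy : adj H x y by apply/exists_inP; exists e; rewrite ?xyE.
have c2 : #|[set u; v]| = 2.
  by rewrite -eE (id_ends_card XHe).
move: eE; rewrite xyE imsetU1 imset_set1 => eE.
have nuv : u != v by move: c2; rewrite cards2; case: eqP.
have : u \in [set contract X x; contract X y] by rewrite eE !inE eqxx.
have : v \in [set contract X x; contract X y] by rewrite eE !inE eqxx orbT.
rewrite !inE => /orP[]/eqP vE /orP[]/eqP uE.
- by rewrite uE vE eqxx in nuv.
- by exists y, x; rewrite adj_sym.
- by exists x, y.
- by rewrite uE vE eqxx in nuv.
Qed.

Lemma connect_identify X x y : connect (adj H) x y ->
  connect (adj (identify H X)) (contract X x) (contract X y).
Proof.
case/connectP=> p + ->; elim: p x => //= z p IHp x /andP[/exists_inP[e He /eqP eE]].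
move/IHp; apply: connect_trans.
(* An edge inside [X] is deleted, but both its ends contract to [None], so the walk merely loses a
   step. *)
have [sX|nsX] := boolP (ends H e \subset X).
  move: sX; rewrite eE subUset !sub1set => /andP[Xx Xz].
  by rewrite /contract Xx Xz connect0.
apply: connect1; apply/exists_inP; exists e; first by rewrite inE He.
by rewrite /= eE imsetU1 imset_set1.
Qed.

(** [contract] is injective outside [X], so a walk to [None] lifts to [H] edge by edge until it
    first meets [X]. *)
Lemma connect_identifyP X x :
  reflect (exists2 y, y \in X & connect (adj H) x y)
    (connect (adj (identify H X)) (contract X x) None).
Proof.
apply: (iffP idP) => [|[y Xy /(connect_identify X)]]; last by rewrite /contract Xy.
have hX z : z \in X -> exists2 y, y \in X & connect (adj H) z y.
  by move=> Xz; exists z.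
case/connectP=> p; elim: p x => /= [|u p IHp] x.
  by rewrite /contract; case: ifP => // /hX.
case/andP=> /adj_identify[x' [y [xy xE ->]]] hp /(IHp _ hp)[z Xz yz].
have [/hX //|nXx] := boolP (x \in X).
have -> : x = x'.
  by move: xE; rewrite /contract (negbTE nXx); case: ifP => // _ [].
by exists z => //; apply: connect_trans (connect1 xy) yz.
Qed.

(** The merged vertex [None] always belongs to [idset X K], so it serves as the base terminal. *)
Lemma Mconn_identifyP X K : K \subset vertices H ->
  reflect {in K, forall k, exists2 x, x \in X & connect (adj H) k x}
    [exists C in components (identify H X), idset X K \subset C].
Proof.
move=> sKV; have sV : idset X K \subset vertices (identify H X).
  by rewrite setUS // imsetS // setSD.
have N0 : None \in idset X K by rewrite !inE.
apply: (iffP (MconnP sV N0)) => [h k Kk | h u].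
  apply/connect_identifyP; rewrite connect_adj_sym; apply: h.
  rewrite /contract !inE; case: ifP => //= nXk.
  by rewrite mem_imset ?inE ?nXk //; apply: Some_inj.
rewrite !inE => /orP[/eqP-> | /imsetP[k /setDP[Kk nXk] ->]]; first exact: connect0.
have -> : Some k = contract X k by rewrite /contract (negbTE nXk).
by rewrite connect_adj_sym; apply/connect_identifyP/h.
Qed.

End Identify.

(** * Restriction and labelled blocks, read off at points *)

Section LabelledPartition.
Variable T : finType.
Implicit Types (W Y : {set T}).

Lemma lblk_lrestr W Y (s : lpart W) (sYW : Y \subset W) x : x \in Y ->
  lblk (LPart (lrestrP s sYW)) x = lblk s x :&: (None |: Some @: Y).
Proof.
move=> Yx; have [sA Ax] := lblkP s (subsetP sYW x Yx).
have YSx : Some x \in Some @: Y by apply: imset_f.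
apply: lblk_def; last by rewrite inE Ax !inE YSx.
apply/imsetP; exists (lblk s x) => //.
by rewrite inE sA; apply/set0Pn; exists (Some x); rewrite inE Ax.
Qed.

Lemma mem_labelled_blocksP Y (s : lpart Y) A :
  reflect (exists x, [/\ x \in Y, None \in lblk s x & A = lblk s x])
    (A \in labelled_blocks s).
Proof.
apply: (iffP setIdP) => [[sA NA] | [x [Yx Nx ->]]]; last by case: (lblkP s Yx).
have [x Ax] := lpart_neq0 sA; exists x.
by rewrite (lblk_def sA Ax) (lpart_dom sA Ax).
Qed.

Lemma labelled_blocks_neq0P Y (s : lpart Y) :
  reflect (exists2 x, x \in Y & None \in lblk s x) (labelled_blocks s != set0).
Proof.
apply: (iffP (set0Pn _)) => [[A /mem_labelled_blocksP[x [Yx Nx _]]] | [x Yx Nx]].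
  by exists x.
by exists (lblk s x); apply/mem_labelled_blocksP; exists x.
Qed.

Lemma card_labelled_blocks1P Y (s : lpart Y) :
  reflect ((exists2 x, x \in Y & None \in lblk s x) /\
           {in Y &, forall x y, None \in lblk s x -> None \in lblk s y ->
              Some y \in lblk s x})
    (#|labelled_blocks s| == 1).
Proof.
apply: (iffP cards1P) => [[A sA] | [[x Yx Nx] h]].
  split; first by apply/labelled_blocks_neq0P/set0Pn; exists A; rewrite sA !inE.
  move=> x y Yx Yy Nx Ny; have eqA z : z \in Y -> None \in lblk s z -> lblk s z = A.
    move=> Yz Nz; apply/set1P; rewrite -sA.
    by apply/mem_labelled_blocksP; exists z.
  by rewrite eqA // -(eqA y) //; case: (lblkP s Yy).
exists (lblk s x); apply/setP => A; rewrite inE.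
apply/mem_labelled_blocksP/eqP => [[y [Yy Ny ->]] | ->]; last by exists x.
by have [sA _] := lblkP s Yx; apply: lblk_def sA (h _ _ Yx Yy Nx Ny).
Qed.

End LabelledPartition.

(** * The partition $\{(H,K)\}\sqcap X$ and the collapse of the sum *)

Section ComponentRestriction.
Variables (T Te : finType) (H : mgraph T Te) (K X : {set T}).
Hypothesis sXV : X \subset vertices H.

Definition comp_restr : lpart X := LPart (lrestrP (lcomp H K) sXV).

Lemma comp_restrS x y : x \in X ->
  (Some y \in lblk comp_restr x) = (y \in X) && connect (adj H) x y.
Proof.
move=> Xx; have Vx := subsetP sXV x Xx.
rewrite lblk_lrestr // inE lblk_equivS // !inE /= mem_imset; last exact: Some_inj.
case Xy: (y \in X); last by rewrite andbF.
by rewrite (subsetP sXV) ?andbT.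
Qed.

(** [k] ranges over all of [K], not only [K :&: X]: restriction keeps the label of a block even when
    its terminals are cut away. *)
Lemma comp_restrN x : x \in X ->
  reflect (exists2 k, k \in K & connect (adj H) x k)
    (None \in lblk comp_restr x).
Proof.
move=> Xx; have Vx := subsetP sXV x Xx.
rewrite lblk_lrestr // inE !inE /= andbT.
apply: (iffP (lblk_equivN (connect_adj_equiv H) K Vx)) => [[k [_ xk Kk]] | [k Kk xk]]; exists k => //.
by rewrite (connect_vertices xk).
Qed.

(** [Dfun H K] is the indicator of [comp_restr], so at most one term survives. *)
Lemma sum_Dfun (A : {set lpart X}) (F : lpart X -> nat) :
  \sum_(s in A) Dfun H K s * F s = (comp_restr \in A) * F comp_restr.
Proof.
have DE s : Dfun H K s = (s == comp_restr) by rewrite /Dfun eq_sym.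
rewrite (eq_bigr (fun s => if s == comp_restr then F s else 0)); last first.
  by move=> s _; rewrite DE; case: eqP => _; rewrite ?mul1n.
rewrite -big_mkcondr big_mkcond /= (bigD1 comp_restr) //= eqxx andbT big1.
  by case: (_ \in A); rewrite addn0 ?mul1n.
by move=> s /negbTE->; rewrite andbF.
Qed.

End ComponentRestriction.

(** The point of a labelled singleton is itself a terminal of [H], so the empty walk labels its
    block. Membership in [PiAbove] thus reduces to having a labelled block. *)
Lemma pi_le_comp_restr (T Te : finType) (H : mgraph T Te) (K X : {set T})
    (sXV : X \subset vertices H) :
  (pi_ X K <= comp_restr (K :&: vertices H) sXV)%O.
Proof.
apply/lpart_leP => x Xx; apply/subsetP => -[y|].
  rewrite lblk_equivS // => /andP[_ /eqP <-].
  by rewrite comp_restrS // Xx connect0.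
case/(lblk_equivN _ _ Xx) => y [_ /eqP <- Ky]; apply/comp_restrN => //.
by exists x; rewrite ?connect0 // inE Ky (subsetP sXV).
Qed.

(** * Walks in a split graph *)

Lemma K_splitting_sym (T Te : finType) (G G1 G2 : mgraph T Te) (K X : {set T}) :
  K_splitting G K G1 G2 X -> K_splitting G K G2 G1 X.
Proof.
by case=> *; split; rewrite // ?[edges G2 :|: _]setUC ?[edges G2 :&: _]setIC
  ?[vertices G2 :|: _]setUC ?[vertices G2 :&: _]setIC.
Qed.

Section Splitting.
Variables (T Te : finType) (G G1 G2 : mgraph T Te) (K X : {set T}).
Hypothesis hsplit : K_splitting G K G1 G2 X.

Lemma split_sub1V : X \subset vertices G1.
Proof. by rewrite -(split_verticesI hsplit) subsetIl. Qed.

Lemma split_mem x : x \in vertices G1 -> x \in vertices G2 -> x \in X.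
Proof. by rewrite -(split_verticesI hsplit) inE => -> ->. Qed.

Lemma split_adj1 : subrel (adj G1) (adj G).
Proof.
have [_ sE eE] := split_sub1 hsplit.
move=> x y /exists_inP[e G1e eqe]; apply/exists_inP.
by exists e; rewrite ?(subsetP sE) -?eE.
Qed.

Lemma split_connect1 x y : connect (adj G1) x y -> connect (adj G) x y.
Proof. by apply: connect_sub => u v /split_adj1/connect1. Qed.

Lemma split_adj x y : adj G x y -> adj G1 x y || adj G2 x y.
Proof.
have [[_ _ e1] [_ _ e2]] := (split_sub1 hsplit, split_sub2 hsplit).
case/exists_inP=> e; rewrite -(split_edgesU hsplit) => /setUP[] Ge eqe.
  by apply/orP; left; apply/exists_inP; exists e; rewrite ?e1.
by apply/orP; right; apply/exists_inP; exists e; rewrite ?e2.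
Qed.

Lemma split_cross x y : connect (adj G) x y ->
    x \in vertices G1 -> y \in vertices G2 ->
  exists2 z, z \in X & connect (adj G1) x z.
Proof.
case/connectP=> p + ->; elim: p x => /= [x _ V1x V2x|z p IHp x].
  by exists x; rewrite ?split_mem.
case/andP=> xz hp V1x V2l; case/orP: (split_adj xz) => [xz1|xz2].
  have /andP[_ V1z] := adj_vertices xz1.
  have [u Xu zu] := IHp _ hp V1z V2l.
  by exists u => //; apply: connect_trans (connect1 xz1) zu.
by have /andP[V2x _] := adj_vertices xz2; exists x; rewrite ?split_mem.
Qed.

End Splitting.

(** * The join of the two restricted partitions as connectivity in [G] *)

Section Join.
Variables (T Te : finType) (G G1 G2 : mgraph T Te) (K X K1 K2 : {set T}).
Hypothesis hsplit : K_splitting G K G1 G2 X.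
Hypotheses (sX1 : X \subset vertices G1) (sX2 : X \subset vertices G2).
Let s1 := comp_restr K1 sX1.
Let s2 := comp_restr K2 sX2.
Let hsplit' := K_splitting_sym hsplit.

Lemma linked_comp_restr x y : x \in X -> y \in X ->
  linked s1 s2 x y = connect (adj G1) x y || connect (adj G2) x y.
Proof.
move=> Xx Xy; apply/linkedP/orP; rewrite !comp_restrS // Xy /=; first by case.
by split.
Qed.

(* The walk is prefixed by a walk from X that stays inside one side; whenever
   the side changes at a vertex v, v lies in X and the prefix is one link. *)
Lemma linked_walk x v p : x \in X -> path (adj G) v p -> last v p \in X ->
    connect (adj G1) x v \/ connect (adj G2) x v ->
  connect (linked s1 s2) x (last v p).
Proof.
elim: p x v => /= [|w p IHp] x v Xx; first by
  move=> _ Xv /orP xv; rewrite connect1 ?linked_comp_restr.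
have [V1x V2x] := (subsetP sX1 x Xx, subsetP sX2 x Xx).
case/andP=> /(split_adj hsplit)/orP vw hp Xl xv.
have link : v \in X -> connect (linked s1 s2) x v.
  by move=> Xv; rewrite connect1 ?linked_comp_restr //; apply/orP.
case: xv vw => xv [] vw.
- by apply: IHp => //; left; apply: connect_trans xv (connect1 vw).
- have [/andP[V2v _] V1v] := (adj_vertices vw, connect_vertices xv V1x).
  have Xv := split_mem hsplit V1v V2v.
  by apply: connect_trans (link Xv) _; apply: IHp => //; right; apply: connect1.
- have [/andP[V1v _] V2v] := (adj_vertices vw, connect_vertices xv V2x).
  have Xv := split_mem hsplit V1v V2v.
  by apply: connect_trans (link Xv) _; apply: IHp => //; left; apply: connect1.
- by apply: IHp => //; right; apply: connect_trans xv (connect1 vw).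
Qed.

Lemma join_comp_restrS x y : x \in X -> y \in X ->
  (Some y \in lblk (s1 `|` s2)%O x) = connect (adj G) x y.
Proof.
move=> Xx Xy; rewrite lpart_joinE lblk_equivS // Xy /=.
apply/idP/idP => [|/connectP[p hp y_p]]; last first.
  (* The initial prefix is the empty walk at [x], counted on the side of [G1]. *)
  by rewrite y_p linked_walk -?y_p //; left; apply: connect0.
apply: connect_sub => u v /linkedP[Xu]; rewrite !comp_restrS //.
by case=> /andP[_]; [apply: split_connect1 hsplit _ _ | apply: split_connect1 hsplit' _ _].
Qed.

(** A joined block gets its label from some point [y] of [X], possibly other than [x], whose own
    block in [s1] or [s2] is labelled. *)
Lemma join_comp_restrN x : x \in X ->
  reflect (exists y k, [/\ y \in X, connect (adj G) x y
             & k \in K1 /\ connect (adj G1) y k \/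
               k \in K2 /\ connect (adj G2) y k])
    (None \in lblk (s1 `|` s2)%O x).
Proof.
move=> Xx; rewrite lpart_joinE.
apply: (iffP (lblk_equivN _ _ Xx)) => [[y [Xy]] | [y [k [Xy]]]]; last first.
  rewrite -join_comp_restrS // lpart_joinE lblk_equivS // Xy /= => xy yk.
  exists y; split=> //; rewrite inE; apply/orP.
  by case: yk => -[Kk yk]; [left | right]; apply/comp_restrN => //; exists k.
move=> xy; rewrite inE => Ny; exists y.
have xy' : connect (adj G) x y.
  by rewrite -join_comp_restrS // lpart_joinE lblk_equivS // Xy.
case/orP: Ny => /comp_restrN-/(_ Xy)[k Kk yk]; exists k; split=> //.
  by left.
by right.
Qed.

End Join.

Theorem theorem5p15 (T Te : finType) (G G1 G2 : mgraph T Te) (K X : {set T})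
    (hK : K \subset vertices G) (hK2 : 2 <= #|K|)
    (hsplit : K_splitting G K G1 G2 X) :
  let K1 := K :&: vertices G1 in
  let K2 := K :&: vertices G2 in
  Mconn G K =
    Mconn (identify G1 X) (idset X K1) * Mconn (identify G2 X) (idset X K2) *
    \sum_(s1 in PiAbove (pi_ X K)) \sum_(s2 in PiAbove (pi_ X K))
       Dfun G1 K1 s1 * mfun (s1 `|` s2)%O * Dfun G2 K2 s2.
Proof.
move=> K1 K2; have hsplit' := K_splitting_sym hsplit.
have [sX1 sX2] := (split_sub1V hsplit, split_sub1V hsplit').
have [[k1 K1k1] [k2 K2k2]] := (set0Pn _ (split_terms1 hsplit), set0Pn _ (split_terms2 hsplit)).
have [[Kk1 V1k1] [Kk2 V2k2]] := (setIP K1k1, setIP K2k2).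
have [sK1 sK2] : K1 \subset vertices G1 /\ K2 \subset vertices G2.
  by rewrite !subsetIr.
have joinS := join_comp_restrS K1 K2 hsplit sX1 sX2.
have joinN := join_comp_restrN K1 K2 hsplit sX1 sX2.
pose s1 := comp_restr K1 sX1; pose s2 := comp_restr K2 sX2.
have -> : \sum_(s1 in PiAbove (pi_ X K)) \sum_(s2 in PiAbove (pi_ X K))
       Dfun G1 K1 s1 * mfun (s1 `|` s2)%O * Dfun G2 K2 s2
    = (s1 \in PiAbove (pi_ X K)) * ((s2 \in PiAbove (pi_ X K)) * mfun (s1 `|` s2)%O).
  (* The right side is expanded back into sums: the outer one first, then the inner one for each
     [s]. *)
  rewrite -(sum_Dfun K1 sX1 _ (fun s => _ * mfun (s `|` s2)%O)).
  apply: eq_bigr => s _.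
  rewrite -(sum_Dfun K2 sX2 _ (fun s' => mfun (s `|` s')%O)) big_distrr.
  by apply: eq_bigr => s' _; rewrite /= -mulnA [mfun _ * _]mulnC.
(* All factors are 0 or 1, so the equation becomes an equivalence of propositions. *)
rewrite !inE !pi_le_comp_restr /= /Mconn /mfun -/s1 -/s2 !mulnb; congr nat_of_bool.
apply/(MconnP hK Kk1)/idP => [hconn | ]; last first.
  case/and4P=> /andP[/(Mconn_identifyP _ sK1) h1 /(Mconn_identifyP _ sK2) h2] _ _.
  case/card_labelled_blocks1P=> _ huniq.
  (* [k] itself labels the block of the point of [X] it reaches, so uniqueness of the labelled block
     connects any two terminals. *)
  have hX k : k \in K -> exists x, [/\ x \in X, connect (adj G) k x
                            & None \in lblk (s1 `|` s2)%O x].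
    move=> Kk; have := subsetP hK k Kk; rewrite -(split_verticesU hsplit).
    case/setUP=> Vk.
      have Kik : k \in K1 by rewrite inE Kk.
      have [x Xx kx] := h1 _ Kik; exists x.
      split=> //; first exact: split_connect1 hsplit _ _ kx.
      apply/joinN => //; exists x, k.
      by split; rewrite ?connect0 //; left; rewrite connect_adj_sym.
    have Kik : k \in K2 by rewrite inE Kk.
    have [x Xx kx] := h2 _ Kik; exists x.
    split=> //; first exact: split_connect1 hsplit' _ _ kx.
    apply/joinN => //; exists x, k.
    by split; rewrite ?connect0 //; right; rewrite connect_adj_sym.
  move=> k /hX[y [Xy ky Ny]]; have [x [Xx k1x Nx]] := hX _ Kk1.
  have := huniq _ _ Xx Xy Nx Ny; rewrite joinS // => xy.
  by apply: connect_trans k1x (connect_trans xy _); rewrite connect_adj_sym.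
have hG k k' : k \in K -> k' \in K -> connect (adj G) k k'.
  by move=> /hconn kk /hconn; apply: connect_trans; rewrite connect_adj_sym.
(* A terminal on the opposite side, here [k2] and below [k1], is the target that forces the walk to
   meet [X]. *)
have reach1 : {in K1, forall k, exists2 x, x \in X & connect (adj G1) k x}.
  by move=> k /setIP[Kk V1k]; apply: split_cross hsplit _ _ (hG _ _ Kk Kk2) V1k V2k2.
have reach2 : {in K2, forall k, exists2 x, x \in X & connect (adj G2) k x}.
  by move=> k /setIP[Kk V2k]; apply: split_cross hsplit' _ _ (hG _ _ Kk Kk1) V2k V1k1.
(* [x1] and [x2] witness a labelled block on each side; [x1] also does so for the join. *)
have [[x1 Xx1 kx1] [x2 Xx2 kx2]] := (reach1 _ K1k1, reach2 _ K2k2).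
rewrite connect_adj_sym in kx1; rewrite connect_adj_sym in kx2.
apply/and4P; split.
- by apply/andP; split; apply/Mconn_identifyP.
- apply/labelled_blocks_neq0P; exists x1 => //.
  by apply/comp_restrN => //; exists k1.
- apply/labelled_blocks_neq0P; exists x2 => //.
  by apply/comp_restrN => //; exists k2.
apply/card_labelled_blocks1P; split.
  exists x1 => //; apply/joinN => //; exists x1, k1.
  by split; rewrite ?connect0 //; left.
(* A label comes from a terminal in the same component of [G], so labelled points are connected
   through [K]. *)
have labK x : x \in X -> None \in lblk (s1 `|` s2)%O x ->
    exists2 k, k \in K & connect (adj G) x k.
  move=> Xx /(joinN _ Xx)[y [k [Xy xy yk]]]; exists k.
    by case: yk => -[/setIP[]].
  apply: connect_trans xy _.
  by case: yk => -[_]; [apply: split_connect1 hsplit _ _ | apply: split_connect1 hsplit' _ _].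
move=> x y Xx Xy /(labK _ Xx)[k Kk xk] /(labK _ Xy)[k' Kk' yk'].
rewrite joinS //; apply: connect_trans xk _.
by apply: connect_trans (hG _ _ Kk Kk') _; rewrite connect_adj_sym.
Qed.
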